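(* Let $N\ge 1$ and $n\ge 1$ be integers, let $A=(\mathbb{Z}/N\mathbb{Z})[X_1,\dots,X_n]$, and let $M=H_m/U$ be a finitely presented $A$-module, where $H_m$ is a free $A$-module of finite rank $m\ge1$ and $U$ is a finitely generated submodule of $H_m$. Then $M$ admits a resolution by free $A$-modules of finite rank $$\cdots \stackrel{\varphi_{p+3}}\longrightarrow F_{p} \stackrel{\varphi_{p+2}}\longrightarrow F_{p} \stackrel{\varphi_{p+1}}\longrightarrow F_{p} \stackrel{\varphi_{p}}\longrightarrow F_{p-1} \stackrel{\varphi_{p-1}}\longrightarrow \cdots \stackrel{\varphi_{2}}\longrightarrow F_{1} \stackrel{\varphi_{1}}\longrightarrow F_{0} \stackrel{\varphi_{0}}\longrightarrow M \longrightarrow 0$$ such that for some $p \leq n+1$, some basis $(\epsilon_1,\dots,\epsilon_{m_p})$ of $F_p$ and some $b_1,\dots,b_{m_p}\in\mathbb{Z}/N\mathbb{Z}$, $$\operatorname{LT}(\operatorname{Ker}(\varphi_{p+2k}))=\bigoplus_{j=1}^{m_p}\langle b_j\rangle\epsilon_j\quad\text{and}\quad \operatorname{LT}(\operatorname{Ker}(\varphi_{p+2k+1}))=\bigoplus_{j=1}^{m_p}\Big\langle \frac{N}{\gcd(N,b_j)}\Big\rangle\epsilon_j\qquad\text{for all }k\ge 0,$$ where the considered monomial orders are Schreyer's monomial orders.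
   Context: Elements of $R=\mathbb{Z}/N\mathbb{Z}$ are identified with their representatives in $\{0,\dots,N-1\}$; $\gcd(N,b)$ is the integer gcd of $N$ and the representative of $b$ (so $\gcd(N,0)=N$), and $\langle c\rangle$ denotes the ideal of $A$ generated by $c$. Let $F$ be a free $A$-module with a finite basis $(\epsilon_1,\dots,\epsilon_q)$. A monomial of $F$ is a vector $X^\alpha\epsilon_\ell$ with $X^\alpha=X_1^{\alpha_1}\cdots X_n^{\alpha_n}$. A monomial order on $F$ is a total order $>$ on its monomials such that $X^\gamma P>P$ for every monomial $P$ of $F$ and every $X^\gamma\neq1$, and such that $P>Q$ implies $X^\gamma P>X^\gamma Q$. For $0\ne h\in F$, written as an $R$-linear combination of distinct monomials with nonzero coefficients, $\operatorname{LM}(h)$ is the largest monomial occurring, $\operatorname{LC}(h)$ its coefficient and $\operatorname{LT}(h)=\operatorname{LC}(h)\operatorname{LM}(h)$; $\operatorname{LT}(0)=0$. For a submodule $W$ of $F$, $\operatorname{LT}(W)$ is the submodule of $F$ generated by all $\operatorname{LT}(w)$, $w\in W$. Schreyer's monomial order on $A^q$ (canonical basis $\epsilon_1,\dots,\epsilon_q$) induced by a monomial order $>$ on $F'$ and nonzero $g_1,\dots,g_q\in F'$ is defined by: $X^\alpha\epsilon_\ell>X^\beta\epsilon_k$ iff either $\operatorname{LM}(X^\alpha g_\ell)>\operatorname{LM}(X^\beta g_k)$, or $\operatorname{LM}(X^\alpha g_\ell)=\operatorname{LM}(X^\beta g_k)$ and $\ell<k$ (here $\operatorname{LM}(X^\alpha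 g)=X^\alpha \operatorname{LM}(g)$). Meaning of the last clause of the claim: $F_0=H_m$ carries some monomial order, and at each step of the resolution where indeterminates are still present in the leading terms of the images $\varphi_i(\epsilon_1),\varphi_i(\epsilon_2),\dots$ of the basis vectors of the source of $\varphi_i$ ($i\ge1$), the source of $\varphi_i$ carries Schreyer's monomial order induced by the order on the target and by these images; at the steps where no indeterminates are present any longer, the monomial order is left unspecified. *)

(* Defs.v *)
From HB Require Import structures.
From mathcomp Require Import all_boot all_order all_algebra finmap.
From mathcomp.multinomials Require Import monalg.

Set Implicit Arguments.
Unset Strict Implicit.
Unset Printing Implicit Defensive.

Import GRing.Theory.

Local Open Scope fset.
Local Open Scope ring_scope.

(* MathComp's 'Z_N is Z/2 when N = 1, and both {poly R} and {mpoly R[n]} ask   *)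
(* for 1 != 0 in R. The rings below are therefore pzRingTypes, which include  *)
(* the zero ring Z/1 and the polynomials over it.                             *)

(* Z/N for 0 < N: the ordinals below N with arithmetic modulo N. For N = 0,   *)
(* the type is that of Z/1.                                                   *)
Definition Zmod (N : nat) : Type := 'I_N.-1.+1.

HB.instance Definition _ N := GRing.Zmodule.on (Zmod N).

Section ZmodRing.
Variable N : nat.
Implicit Types x y : Zmod N.

Definition zmul x y : Zmod N := Zp_mul x y.
Definition zone : Zmod N := Zp1.

Fact zmulA : associative zmul. Proof. exact: Zp_mulA. Qed.
Fact zmulC : commutative zmul. Proof. exact: Zp_mulC. Qed.
Fact zmul1 : left_id zone zmul. Proof. exact: Zp_mul1z. Qed.
Fact zmulDl : left_distributive zmul +%R. Proof. exact: Zp_mul_addl. Qed.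
Fact zmulr1 : right_id zone zmul. Proof. exact: Zp_mulz1. Qed.
Fact zmulDr : right_distributive zmul +%R. Proof. exact: Zp_mul_addr. Qed.

HB.instance Definition _ := GRing.Zmodule_isComPzRing.Build (Zmod N)
  zmulA zmulC zmul1 zmulDl.

End ZmodRing.

Definition repr_of (N : nat) (b : Zmod N) : nat := val b.

(* (Z/N)[X_1, ..., X_n], as finitely supported families of coefficients       *)
(* indexed by the monomials of 'X_{1..n}, with the convolution product.       *)
Definition zpoly (N n : nat) : Type := {malg (Zmod N)['X_{1..n}]}.

HB.instance Definition _ N n := GRing.Zmodule.on (zpoly N n).

Section PolyRing.
Variables N n : nat.
Implicit Types f g h : zpoly N n.

(* pmul and pterm are locked: unfolding them makes unification diverge.       *)
Fact pterm_key : unit. Proof. by []. Qed.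
Definition pterm : Zmod N -> 'X_{1..n} -> zpoly N n :=
  locked_with pterm_key (fun c a => << c *g a >>).

Lemma ptermE c a : pterm c a = << c *g a >>.
Proof. by rewrite /pterm unlock. Qed.

Definition pconst (c : Zmod N) : zpoly N n := pterm c mone.
Definition pcoef (a : 'X_{1..n}) f : Zmod N := f@_a.

Fact pmul_key : unit. Proof. by []. Qed.
Definition pmul : zpoly N n -> zpoly N n -> zpoly N n :=
  locked_with pmul_key (fun f g =>
    \sum_(a <- msupp f) \sum_(b <- msupp g) pterm (f@_a * g@_b) (mmul a b)).

Lemma pmulE f g :
  pmul f g = \sum_(a <- msupp f) \sum_(b <- msupp g) pterm (f@_a * g@_b) (mmul a b).
Proof. by rewrite /pmul unlock. Qed.

Lemma ptermD a : {morph pterm^~ a : c d / c + d}.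
Proof. by move=> c d; rewrite !ptermE; exact: monalgUD. Qed.

Lemma pterm0 a : pterm 0 a = 0.
Proof. by rewrite ptermE; exact: monalgU0. Qed.

Lemma pmulw (d1 d2 : {fset 'X_{1..n}}) f g :
  msupp f `<=` d1 -> msupp g `<=` d2 ->
  pmul f g = \sum_(a <- d1) \sum_(b <- d2) pterm (f@_a * g@_b) (mmul a b).
Proof.
move=> le1 le2; rewrite pmulE (big_fset_incl _ le1) /=; last first.
  by move=> a _ /mcoeff_outdom fa; rewrite big1 // => b _; rewrite fa mul0r pterm0.
apply/eq_bigr=> a _; apply/big_fset_incl => // b _ /mcoeff_outdom ->.
by rewrite mulr0 pterm0.
Qed.

Lemma pmulC : commutative pmul.
Proof.
move=> f g; rewrite !pmulE exchange_big; apply/eq_bigr=> a _.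
by apply/eq_bigr=> b _; rewrite mulrC mulmC.
Qed.

Lemma pmulDl : left_distributive pmul +%R.
Proof.
move=> f g h.
rewrite (pmulw (msuppD_le f g) (fsubset_refl (msupp h))).
rewrite (pmulw (fsubsetUl (msupp f) (msupp g)) (fsubset_refl (msupp h))).
rewrite (pmulw (fsubsetUr (msupp f) (msupp g)) (fsubset_refl (msupp h))).
rewrite -big_split /=; apply/eq_bigr=> a _.
rewrite -big_split /=; apply/eq_bigr=> b _.
by rewrite mcoeffD mulrDl ptermD.
Qed.

Lemma pmulDr : right_distributive pmul +%R.
Proof. by move=> f g h; rewrite pmulC pmulDl !(pmulC f). Qed.

Lemma pmul0 : left_zero 0 pmul.
Proof. by move=> f; rewrite pmulE msupp0 big_seq_fset0. Qed.

Lemma pmulr0 : right_zero 0 pmul.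
Proof. by move=> f; rewrite pmulC pmul0. Qed.

Lemma pmulUU c d a b :
  pmul (pterm c a) (pterm d b) = pterm (c * d) (mmul a b).
Proof.
have le e x : msupp (pterm e x) `<=` [fset x] by rewrite ptermE; exact: msuppU_le.
rewrite (pmulw (le c a) (le d b)) !big_seq_fset1.
by rewrite (ptermE c) (ptermE d) !mcoeffUU.
Qed.

Lemma polyE f : f = \sum_(a <- msupp f) pterm f@_a a.
Proof. by rewrite [LHS](monalgE f); apply/eq_bigr=> a _; rewrite ptermE. Qed.

Lemma additive_ext (F G : zpoly N n -> zpoly N n) :
  {morph F : f g / f + g} -> {morph G : f g / f + g} -> F 0 = G 0 ->
  (forall c a, F (pterm c a) = G (pterm c a)) -> F =1 G.
Proof.
move=> FD GD FG0 FG f; rewrite [f]polyE.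
elim: (X in \sum_(a <- X) _) => [|a s IHs]; first by rewrite !big_nil.
by rewrite !big_cons FD GD IHs FG.
Qed.

Lemma pmul1 : left_id (pconst 1) pmul.
Proof.
apply: additive_ext => [f g|//||c a]; [exact: pmulDr|exact: pmulr0|].
by rewrite pmulUU mul1r mul1m.
Qed.

Lemma pmulA : associative pmul.
Proof.
move=> f g h; move: f.
apply: (@additive_ext (fun f => pmul f (pmul g h))
                      (fun f => pmul (pmul f g) h)).
- by move=> f1 f2; rewrite pmulDl.
- by move=> f1 f2; rewrite (pmulDl f1) pmulDl.
- by rewrite (pmul0 (pmul g h)) (pmul0 g) (pmul0 h).
move=> c a; move: g.
apply: (@additive_ext (fun g => pmul (pterm c a) (pmul g h))
                      (fun g => pmul (pmul (pterm c a) g) h)).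
- by move=> g1 g2; rewrite (pmulDl g1) pmulDr.
- by move=> g1 g2; rewrite (pmulDr _ g1) pmulDl.
- by rewrite (pmul0 h) (pmulr0 (pterm c a)) (pmul0 h).
move=> d b; move: h.
apply: (@additive_ext (fun h => pmul (pterm c a) (pmul (pterm d b) h))
                      (fun h => pmul (pmul (pterm c a) (pterm d b)) h)).
- by move=> h1 h2; rewrite (pmulDr (pterm d b)) pmulDr.
- by move=> h1 h2; rewrite pmulDr.
- by rewrite (pmulr0 (pterm d b)) !pmulr0.
by move=> e b'; rewrite !pmulUU mulrA mulmA.
Qed.

HB.instance Definition _ := GRing.Zmodule_isComPzRing.Build (zpoly N n)
  pmulA pmulC pmul1 pmulDl.

End PolyRing.

Section Submodules.
Variables (A : comPzRingType) (V : lmodType A).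

Definition same_submod (U W : V -> Prop) : Prop := forall v, U v <-> W v.

Definition submod_gen (G : V -> Prop) (v : V) : Prop :=
  exists (k : nat) (a : 'I_k -> A) (g : 'I_k -> V),
    (forall i, G (g i)) /\ v = \sum_(i < k) a i *: g i.

Definition fg_submod (U : V -> Prop) : Prop :=
  exists s : seq V, same_submod U (submod_gen (fun v => v \in s)).

End Submodules.

Definition ideal_gen (A : comPzRingType) (c a : A) : Prop :=
  exists d : A, a = d * c.

Section MonomialOrders.
Variables N n : nat.
Local Notation A := (zpoly N n).

(* (a, l) stands for X^a e_l in A^q. The pairs are used instead of the        *)
(* vectors because all the vectors coincide when N = 1.                       *)
Definition mon (q : nat) : Type := ('X_{1..n} * 'I_q)%type.

HB.instance Definition _ q := Choice.on (mon q).

Definition mon_shift q (c : 'X_{1..n}) (P : mon q) : mon q :=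
  (mmul c P.1, P.2).

Definition basis_vec q (l : 'I_q) : 'rV[A]_q := delta_mx 0 l.

Definition mon_vec q (P : mon q) : 'rV[A]_q := pterm 1 P.1 *: basis_vec P.2.

Definition mon_coef q (P : mon q) (h : 'rV[A]_q) : Zmod N := pcoef P.1 (h 0 P.2).

Definition mon_supp q (h : 'rV[A]_q) : seq (mon q) :=
  [seq (a, l) | l <- enum 'I_q, a <- enum_fset (msupp (h 0 l))].

Lemma mem_mon_supp q (P : mon q) (h : 'rV[A]_q) :
  (P \in mon_supp h) = (mon_coef P h != 0).
Proof.
case: P => a l; rewrite /mon_coef /pcoef mcoeff_neq0 /=.
apply/allpairsPdep/idP => [[k [c [_ hc [-> ->]]]] // | ha].
by exists l, a; split=> //; rewrite mem_enum.
Qed.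

(* gt P Q reads P > Q. *)
Definition monomial_order q (gt : rel (mon q)) : Prop :=
  [/\ irreflexive gt,
      transitive gt,
      forall P Q, P != Q -> gt P Q || gt Q P,
      forall c P, c != mone -> gt (mon_shift c P) P
    & forall c P Q, gt P Q -> gt (mon_shift c P) (mon_shift c Q)].

Definition LM q (gt : rel (mon q)) (h : 'rV[A]_q) : option (mon q) :=
  foldr (fun P best => if best is Some Q
                       then Some (if gt P Q then P else Q)
                       else Some P)
        None (mon_supp h).

Lemma LMP q (gt : rel (mon q)) (h : 'rV[A]_q) (P : mon q) :
  monomial_order gt ->
  LM gt h = Some P <->
  mon_coef P h != 0 /\ forall Q, mon_coef Q h != 0 -> Q != P -> gt P Q.
Proof.
case=> irr tr tot _ _.
suff fold_max s : foldr (fun P best => if best is Some Q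
                       then Some (if gt P Q then P else Q)
                       else Some P) None s = Some P <->
    P \in s /\ forall Q, Q \in s -> Q != P -> gt P Q.
  rewrite /LM fold_max -mem_mon_supp; split=> -[hP hQ]; split=> // Q.
    by rewrite -mem_mon_supp => /hQ.
  by rewrite mem_mon_supp => /hQ.
have fold_none t : (foldr (fun P best => if best is Some Q
                       then Some (if gt P Q then P else Q)
                       else Some P) None t == None) = (t == [::]).
  by case: t => //= x t; case: foldr.
elim: s P => [|x s IHs] P; first by split=> // -[].
move: (fold_none s) IHs => /=; case: foldr => [R|] hs IHs.
- have [Rs hR] := (IHs R).1 erefl; split.
    move=> [<-]; case: ifP => [xR|/negbT xR].
      split=> [|Q]; first by rewrite mem_head.
      rewrite inE => /predU1P[->|Qs]; rewrite ?eqxx // => _.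
      by have [->//|QR] := eqVneq Q R; apply: tr xR (hR _ Qs QR).
    split=> [|Q]; first by rewrite inE Rs orbT.
    rewrite inE => /predU1P[->|Qs QR]; last exact: hR.
    by move/(tot x R); rewrite (negPf xR).
  case; rewrite inE => /predU1P[->|Ps] hP; congr Some; case: ifP => xR //.
  + apply: contraFeq xR; apply: hP; by rewrite inE Rs orbT.
  + have [//|xP] := eqVneq x P; have Px := hP x (mem_head _ _) xP.
    have [RP|RP] := eqVneq R P; first by have:= tr _ _ _ Px xR; rewrite RP irr.
    have:= tr _ _ _ (tr _ _ _ Px xR) (hR P Ps _); rewrite eq_sym RP irr.
    by move=> /(_ isT).
  + have [//|RP] := eqVneq R P.
    have PR := hP R _ RP; have:= tr _ _ _ (PR _) (hR P Ps _).
    by rewrite inE Rs orbT eq_sym RP irr => /(_ isT isT).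
- have/eqP s0 : s == [::] by rewrite -hs.
  rewrite s0; split=> [[->]|[]].
    by rewrite mem_head; split=> // Q; rewrite inE => /eqP->; rewrite eqxx.
  by rewrite inE => /eqP->.
Qed.

Definition LC q (gt : rel (mon q)) (h : 'rV[A]_q) : Zmod N :=
  if LM gt h is Some P then mon_coef P h else 0.

Definition LT q (gt : rel (mon q)) (h : 'rV[A]_q) : 'rV[A]_q :=
  if LM gt h is Some P then pconst n (LC gt h) *: mon_vec P else 0.

Definition LT_submod q (gt : rel (mon q)) (W : 'rV[A]_q -> Prop) :
    'rV[A]_q -> Prop :=
  submod_gen (fun t => exists2 w, W w & t = LT gt w).

(* The value false in the last branch, where some g_l is 0, is irrelevant:    *)
(* Schreyer's order is only defined for nonzero g_l.                          *)
Definition schreyer q q' (gt : rel (mon q')) (g : 'I_q -> 'rV[A]_q') :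
    rel (mon q) := fun P Q =>
  match LM gt (g P.2), LM gt (g Q.2) with
  | Some L, Some L' =>
      let P' := mon_shift P.1 L in let Q' := mon_shift Q.1 L' in
      gt P' Q' || (P' == Q') && (P.2 < Q.2)%N
  | _, _ => false
  end.

Definition has_indeterminates q (gt : rel (mon q)) (h : 'rV[A]_q) : Prop :=
  exists2 P, LM gt h = Some P & P.1 != mone.

(* The submodule (+)_j <b_j> e_j of A^q. *)
Definition dsum_ideals q (b : 'I_q -> Zmod N) (v : 'rV[A]_q) : Prop :=
  exists2 c : 'I_q -> A, forall j, ideal_gen (pconst n (b j)) (c j)
                       & v = \sum_(j < q) c j *: basis_vec j.

Definition N_over_gcd (b : Zmod N) : Zmod N := inZp (N %/ gcdn N (repr_of b)).

End MonomialOrders.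

Section Resolutions.
Variables (A : comPzRingType) (m : nat) (M : lmodType A) (rk : nat -> nat).

(* The ranks of F_0 = A^m, F_1 = A^(rk 0), F_2 = A^(rk 1), and so on.         *)
Definition res_rank (i : nat) : nat := if i is j.+1 then rk j else m.

Definition res_source (i : nat) : lmodType A := 'rV[A]_(res_rank i).

Definition res_target (i : nat) : lmodType A :=
  if i is j.+1 then res_source j else M.

Definition res_maps : Type :=
  forall i, {linear 'rV[A]_(res_rank i) -> res_target i}.

Definition is_resolution (phi : res_maps) : Prop :=
  (forall x : M, exists v, phi 0%N v = x) /\
  (forall i (v : 'rV[A]_(res_rank i)),
     phi i v = 0 <-> exists w, phi i.+1 w = v).

End Resolutions.

(* Main.v *)
Require Import Defs.
From HB Require Import structures.
From mathcomp Require Import all_boot all_order all_algebra finmap.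
From mathcomp.multinomials Require Import monalg.
From Stdlib Require Import Classical ClassicalEpsilon FunctionalExtensionality.

Set Implicit Arguments.
Unset Strict Implicit.
Unset Printing Implicit Defensive.

Import GRing.Theory.

Local Open Scope ring_scope.

(** The resolution is built by iterated syzygy modules, with [p = n].

A Groebner basis of a submodule [K] here is a finite family in [K] such that
every leading term of [K] is a multiple of one of the leading terms of the
family. Since Z/N is finite and monomials satisfy Dickson's lemma ([dickson]),
one can even choose it so that every nonzero [v] in [K] has the same leading
coefficient as some member whose leading monomial divides that of [v]. Dickson's
lemma also makes monomial orders well-founded, so that division by such a basis
terminates, leaves no remainder, and only uses quotients whose lifts do not
exceed the leading monomial of the dividend ([division]).

Steps with indeterminates ([schreyer_lead_free]). Suppose that the leading
monomials of a Groebner basis [g] of [K] do not contain [X_j] for [j < t], and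
sort [g] by decreasing exponent of [X_t]. Let [w] be a syzygy of [g] with leading
monomial [X^beta e_i] for Schreyer's order. The terms of [w] that are lifted to
the same monomial as [X^beta e_i] have indices at least [i], hence basis elements
whose exponent of [X_t] is at most that of [g_i]; so all these terms are divisible
by the part of [X^beta] in the indeterminates [X_0], ..., [X_t]. Dividing by that
part leaves a vector whose image still has a cancelling leading coefficient, and
division completes it to a syzygy with the same leading coefficient as [w] and
with a leading monomial free of [X_0], ..., [X_t]. No S-polynomials have to be
computed. After [n] steps no indeterminate is left.

Steps without indeterminates ([lead_free_pivots], [pivots_syzygies]). As ideals of
Z/N are principal, [K] now has a generating family [u] indexed by the basis of its
ambient module, where [u_k] has leading term [b_k e_k]. For the kernel of
[e_k |-> u_k] keep the same monomial order: the image of a vector with leading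
term [c X^beta e_k] has coefficient [c b_k] at [X^beta e_k], so [c] annihilates
[b_k]; conversely [N/gcd(N, b_k) e_k] is completed to a syzygy by division. The
kernel thus has the same shape with [b_k] replaced by [N/gcd(N, b_k)], and this
replacement is an involution on well chosen generators ([zmod_principal]), whence
the period 2. *)

(** * Ideals and annihilators in Z/N *)

(* Unqualified, [repr_of] denotes representatives in quotient types. *)
Local Notation repr_of := Defs.repr_of.

Lemma dvdn_mul_gcd a b c : (0 < a)%N ->
  (a %| c * b)%N = (a %/ gcdn a b %| c)%N.
Proof.
move=> a0; have g0 : (0 < gcdn a b)%N by rewrite gcdn_gt0 a0.
set g := gcdn _ _ in g0 *.
have [ag bg] : (g %| a /\ g %| b)%N by rewrite dvdn_gcdl dvdn_gcdr.
have co : coprime (a %/ g) (b %/ g).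
  by rewrite /coprime -(eqn_pmul2r g0) muln_gcdl !divnK // mul1n.
by rewrite -{1}(divnK bg) mulnA -{1}(divnK ag) dvdn_pmul2r // Gauss_dvdl.
Qed.

Section Residues.
Variables (N : nat) (hN : (0 < N)%N).
Implicit Types b x : Zmod N.

Lemma repr_of_mul x b : repr_of (x * b) = (repr_of x * repr_of b %% N)%N.
Proof. by case: N hN x b => // N' _ x b. Qed.

Lemma repr_of_inZp k : repr_of (inZp k : Zmod N) = (k %% N)%N.
Proof. by case: N hN => // N' _. Qed.

Lemma repr_of_lt x : (repr_of x < N)%N.
Proof. by case: N hN x => // N' _ x; apply: ltn_ord. Qed.

Lemma zmod_eq0 x : (x == 0) = (N %| repr_of x)%N.
Proof. by rewrite /dvdn modn_small ?repr_of_lt. Qed.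

Lemma inZpD i j : inZp (i + j) = (inZp i : Zmod N) + (inZp j : Zmod N).
Proof. by apply: val_inj; rewrite /= modnDm. Qed.

Lemma inZpM i j : inZp (i * j) = (inZp i : Zmod N) * (inZp j : Zmod N).
Proof. by apply: val_inj; rewrite /= modnMm. Qed.

Lemma zmod_multipleP b x :
  (exists d, x = d * b) <-> (gcdn N (repr_of b) %| repr_of x)%N.
Proof.
split=> [[d ->]|].
  rewrite repr_of_mul /dvdn modn_dvdm ?dvdn_gcdl //.
  by apply: dvdn_mull; exact: dvdn_gcdr.
case/dvdnP=> k xk; have [a _ /dvdnP[c hc]] := Bezoutr (repr_of b) hN.
exists (inZp (k * (a * N.-1))); apply: val_inj.
rewrite -!/(repr_of _) repr_of_mul repr_of_inZp modnMml.
rewrite -[LHS](modn_small (repr_of_lt x)); apply/eqP.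
rewrite -(eqn_modDr (k * a * repr_of b)) xk gcdnC -[(k * a * _)%N]mulnA -mulnDr hc.
have -> : (k * (a * N.-1) * repr_of b + k * (a * repr_of b) =
          k * a * repr_of b * N)%N.
  move: (repr_of b) => r; rewrite -{2}(prednK hN).
  by rewrite mulnS addnC -!mulnA (mulnC N.-1).
by rewrite mulnA !modnMl.
Qed.

Lemma repr_of_N_over_gcd b :
  gcdn N (repr_of (N_over_gcd b)) = (N %/ gcdn N (repr_of b))%N.
Proof.
rewrite /N_over_gcd repr_of_inZp gcdn_modr; apply/gcdn_idPr.
by rewrite dvdn_div // dvdn_gcdl.
Qed.

Lemma zmod_annP b x : x * b = 0 <-> exists d, x = d * N_over_gcd b.
Proof.
rewrite zmod_multipleP repr_of_N_over_gcd; apply: (iff_trans (rwP eqP)).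
by rewrite zmod_eq0 repr_of_mul -dvdn_mul_gcd // /dvdn modn_mod.
Qed.

(** The least gcd of N with an element of the ideal is again the residue of an
element: Euclidean division by it leaves remainders with a smaller gcd. Taking
this divisor of N as the generator makes [b |-> N / gcd(N, b)] an involution on
the nose, and not only up to units, so that the ideals attached to the
resolution repeat with period exactly 2. *)
Lemma zmod_principal (I : Zmod N -> Prop) :
    I 0 -> (forall x y, I x -> I y -> I (x + y)) ->
    (forall d x, I x -> I (d * x)) ->
  exists b, [/\ I b, N_over_gcd (N_over_gcd b) = b
              & forall x, I x -> exists d, x = d * b].
Proof.
move=> I0 ID IM.
have [g [Ig gN minI]] : exists g, [/\ I (inZp g), (g %| N)%N &
    forall x, I x -> (g <= gcdn N (repr_of x))%N].
  suff: forall k x, I x -> (gcdn N (repr_of x) <= k)%N ->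
      exists g, [/\ I (inZp g), (g %| N)%N &
        forall x, I x -> (g <= gcdn N (repr_of x))%N].
    by move/(_ _ 0 I0 (leqnn _)).
  elim=> [|k IHk] x Ix; first by rewrite leqn0 eqn0Ngt gcdn_gt0 hN.
  move=> xk; have [[y [Iy yk]]|noy] :=
      classic (exists y, I y /\ (gcdn N (repr_of y) <= k)%N); first exact: IHk yk.
  exists (gcdn N (repr_of x)); split; last 1 first.
  - move=> y Iy; apply: leq_trans xk _; rewrite ltnNge; apply/negP => yk.
    by apply: noy; exists y.
  - have /(zmod_multipleP x)[d ->] : (gcdn N (repr_of x) %|
        repr_of (inZp (gcdn N (repr_of x)) : Zmod N))%N.
      by rewrite repr_of_inZp /dvdn modn_dvdm ?dvdn_gcdl // modnn.
    exact: IM.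
  - exact: dvdn_gcdl.
have g0 : (0 < g)%N by rewrite (dvdn_gt0 hN).
have gE : gcdn N (repr_of (inZp g : Zmod N)) = g.
  by rewrite repr_of_inZp gcdn_modr; apply/gcdn_idPr.
exists (inZp g); split=> //.
  rewrite /N_over_gcd repr_of_N_over_gcd gE; congr inZp.
  by case/dvdnP: gN hN => k ->; rewrite muln_gt0 => /andP[k0 _]; rewrite mulnK // mulKn.
move=> x Ix; apply/zmod_multipleP; rewrite gE.
have rE : (inZp (repr_of x %% g) : Zmod N) =
    x - (inZp (repr_of x %/ g) : Zmod N) * (inZp g : Zmod N).
  rewrite -{2}(valZpK x) -/(repr_of x) {2}(divn_eq (repr_of x) g).
  by rewrite inZpD inZpM addrC addKr.
have Ir : I (inZp (repr_of x %% g)).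
  by rewrite rE -mulNr; apply: ID => //; apply: IM.
have := minI _ Ir; rewrite repr_of_inZp gcdn_modr => le_g.
rewrite /dvdn eqn0Ngt; apply/negP => r0.
have := leq_trans le_g (dvdn_leq r0 (dvdn_gcdr _ _)).
by rewrite leqNgt ltn_pmod.
Qed.
End Residues.
(** * Dickson's lemma and monomial orders *)

(** Induction on the measures [fs]: a basis [B0] for the other measures is good
enough for all [x] with [f x] at least the maximum of [f] on [B0], and each of
the finitely many slices [f x = j] below that maximum has a basis of its own.
Arbitrary measures on an arbitrary type, instead of exponent vectors, let the
same lemma handle positions and coefficients as well. *)
Lemma dickson (T : eqType) (fs : seq (T -> nat)) (S : T -> Prop) :
  exists B : seq T, (forall x, x \in B -> S x) /\
    forall x, S x -> exists2 y, y \in B & all (fun f => f y <= f x)%N fs.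
Proof.
elim: fs S => [|f fs IHfs] S /=.
  have [[x Sx]|S0] := classic (exists x, S x).
    exists [:: x]; split=> [y|y _]; first by rewrite inE => /eqP->.
    by exists x; rewrite ?mem_head.
  by exists [::]; split=> // x Sx; case: S0; exists x.
have [B0 [SB0 hB0]] := IHfs S.
have slices k : exists B : seq T, (forall x, x \in B -> S x) /\
    forall x, S x -> (f x < k)%N ->
      exists2 y, y \in B & f y = f x /\ all (fun f => f y <= f x)%N fs.
  elim: k => [|k [B [SB hB]]]; first by exists [::].
  have [C [SC hC]] := IHfs (fun x => S x /\ f x = k).
  exists (B ++ C); split=> [x|x Sx].
    by rewrite mem_cat => /orP[/SB //|/SC[]].
  rewrite ltnS leq_eqVlt => /predU1P[fx|/(hB _ Sx)[y yB hy]].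
    have [y yC hy] := hC x (conj Sx fx).
    by exists y; [rewrite mem_cat yC orbT|rewrite fx; case: (SC _ yC)].
  by exists y; rewrite // mem_cat yB.
have [B [SB hB]] := slices (\max_(x <- B0) f x).
exists (B0 ++ B); split=> [x|x Sx].
  by rewrite mem_cat => /orP[/SB0|/SB].
have [fx|fx] := ltnP (f x) (\max_(x <- B0) f x).
  have [y yB [fy hy]] := hB _ Sx fx.
  by exists y; rewrite ?mem_cat ?yB ?orbT // fy leqnn.
have [y yB hy] := hB0 _ Sx; exists y; rewrite ?mem_cat ?yB //= hy andbT.
by apply: leq_trans fx; apply: leq_bigmax_seq.
Qed.

Section Monomials.
Variables n q : nat.
Implicit Types P Q : mon n q.

Definition mdvd P Q := (P.2 == Q.2) && [forall j, (P.1 j <= Q.1 j)%N].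

Lemma mdvdP P Q : reflect (exists c, Q = mon_shift c P) (mdvd P Q).
Proof.
apply: (iffP andP) => [[/eqP PQ /forallP le]|[c ->]]; last first.
  by split=> //; apply/forallP=> j; rewrite cmM leq_addl.
exists (divcm Q.1 P.1); case: P Q PQ le => [a k] [b k'] /= <- le.
congr pair; apply/eqP/cmP=> j.
by rewrite cmM -[divcm b a j]/(divcm b a j) divcmE subnK.
Qed.

Lemma mon_shiftA a b P : mon_shift a (mon_shift b P) = mon_shift (mmul a b) P.
Proof. by rewrite /mon_shift mulmA. Qed.

Lemma mon_shift1 P : mon_shift mone P = P.
Proof. by case: P => a l; rewrite /mon_shift mul1m. Qed.

Lemma mmul_inj (c : 'X_{1..n}) : injective (mmul c).
Proof.
move=> a b /eqP/cmP h; apply/eqP/cmP=> j.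
by have /eqP := h j; rewrite !cmM eqn_add2l => /eqP.
Qed.

Lemma mon_shift_inj c : injective (@mon_shift n q c).
Proof. by move=> [a k] [b l] [/mmul_inj-> ->]. Qed.

Lemma mon_shift_injl P a b : mon_shift a P = mon_shift b P -> a = b.
Proof. by case=> /eqP; rewrite !(mulmC _ P.1) => /eqP/mmul_inj. Qed.

(** A bounded measure is forced to agree exactly by comparing both it and its
complement to the bound; this is done for the position of the monomial and
for [c]. *)
Lemma dickson_mon (T : eqType) (m : T -> mon n q) (c : T -> nat) (C : nat)
    (S : T -> Prop) : (forall x, c x <= C)%N ->
  exists B : seq T, (forall x, x \in B -> S x) /\
    forall x, S x -> exists2 y, y \in B & mdvd (m y) (m x) /\ c y = c x.
Proof.
move=> cC; pose pos x : nat := (m x).2.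
have anti (f : T -> nat) D x y : (f x <= D)%N ->
    (f y <= f x)%N -> (D - f y <= D - f x)%N -> f y = f x.
  move=> fD yx Dyx; apply/eqP; rewrite eqn_leq yx /=.
  by move: Dyx; rewrite leq_sub2lE.
have [B [SB hB]] := dickson ([:: pos; (fun x => q - pos x)%N; c;
  (fun x => C - c x)%N] ++ [seq (fun x => (m x).1 j) | j : 'I_n]) S.
exists B; split=> // x /hB[y yB hy]; exists y => //; move: hy.
rewrite all_cat /= andbT all_map => /andP[/and4P[p1 p2 c1 c2] /allP e]; split.
  apply/andP; split.
    by apply/eqP/val_inj; apply: (anti pos q x y (ltnW (ltn_ord _)) p1 p2).
  by apply/forallP=> j; apply: e; rewrite mem_enum.
exact: (anti c C x y (cC x) c1 c2).
Qed.

End Monomials.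
Section MonomialOrder.
Variables (n q : nat) (gt : rel (mon n q)) (hgt : monomial_order gt).
Implicit Types P Q : mon n q.

Definition ge P Q := (Q == P) || gt P Q.

Lemma gt_irr P : gt P P = false. Proof. by case: hgt => ->. Qed.

Lemma gt_trans P Q R : gt P Q -> gt Q R -> gt P R.
Proof. by case: hgt => _ tr _ _ _; apply: tr. Qed.

Lemma ge_refl P : ge P P. Proof. by rewrite /ge eqxx. Qed.

Lemma gt_ge_trans P Q R : gt P Q -> ge Q R -> gt P R.
Proof. by move=> PQ /predU1P[->//|]; apply: gt_trans. Qed.

Lemma ge_trans P Q R : ge P Q -> ge Q R -> ge P R.
Proof. by move=> /predU1P[->//|PQ QR]; rewrite /ge (gt_ge_trans PQ QR) orbT. Qed.

Lemma geNgt P Q : ge P Q = ~~ gt Q P.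
Proof.
case: hgt => irr _ tot _ _; rewrite /ge; have [->|QP] := eqVneq; first by rewrite irr.
have := tot _ _ QP; have [PQ|] := boolP (gt P Q); last by rewrite orbF => _ ->.
by move=> _; apply/esym/negP => /(gt_trans PQ); rewrite irr.
Qed.

Lemma gt_shift c P Q : gt (mon_shift c P) (mon_shift c Q) = gt P Q.
Proof.
case: hgt => _ _ _ _ sh; apply/idP/idP; last exact: sh.
apply: contraLR; rewrite -!geNgt => /predU1P[->|/(sh c) QP]; first exact: ge_refl.
by rewrite /ge QP orbT.
Qed.

Lemma ge_shift c P Q : ge (mon_shift c P) (mon_shift c Q) = ge P Q.
Proof. by rewrite !geNgt gt_shift. Qed.

Lemma mdvd_ge P Q : mdvd P Q -> ge Q P.
Proof.
case/mdvdP=> c ->; case: hgt => _ _ _ pos _.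
have [->|c1] := eqVneq c mone; first by rewrite mon_shift1 ge_refl.
by rewrite /ge pos ?orbT.
Qed.

(** A monomial is never smaller than its divisors, so the least element of a
finite Dickson basis of [S] is the least element of [S]. *)
Lemma ge_min (S : mon n q -> Prop) :
  (exists P, S P) -> exists2 P, S P & forall Q, S Q -> ge Q P.
Proof.
case=> P0 SP0.
have [B [SB hB]] := @dickson_mon n q (mon n q) id (fun=> 0%N) 0 S (fun=> leqnn 0).
suff [P PB minP] : exists2 P, P \in B & forall Q, Q \in B -> ge Q P.
  exists P; first exact: SB.
  move=> Q /hB[R RB [RQ _]]; exact: ge_trans (mdvd_ge RQ) (minP _ RB).
have: B != [::] by have [y] := hB _ SP0; case: B {SB hB}.
elim: B {SB hB} => // P [|Q B] IHB _.
  by exists P => [|R]; rewrite inE ?eqxx // => /eqP->; apply: ge_refl.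
have [R RB minR] := IHB isT; have [RP|RP] := boolP (ge P R).
  exists R; first by rewrite inE RB orbT.
  by move=> S'; rewrite inE => /predU1P[->|/minR].
exists P; rewrite ?mem_head // => S'; rewrite inE => /predU1P[->|/minR S'R].
  exact: ge_refl.
by apply: ge_trans S'R _; rewrite geNgt; apply: contra RP => PR; rewrite /ge PR orbT.
Qed.

Lemma gt_ind (Pr : mon n q -> Prop) :
  (forall P, (forall Q, gt P Q -> Pr Q) -> Pr P) -> forall P, Pr P.
Proof.
move=> step P; apply: NNPP => nP.
have [Q nQ minQ] := ge_min (ex_intro (fun P => ~ Pr P) P nP).
apply: (nQ); apply: step => R QR; apply: NNPP => /minQ.
by rewrite geNgt QR.
Qed.

End MonomialOrder.

(** * Terms and coefficients *)

Section Coefficients.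
Variables N n q : nat.
Local Notation A := (zpoly N n).
Implicit Types (u v w : 'rV[A]_q) (P Q : mon n q) (c d : Zmod N).

Definition mterm c P : 'rV[A]_q := pterm c P.1 *: basis_vec N n P.2.

Lemma mon_coef0 P : mon_coef P (0 : 'rV[A]_q) = 0.
Proof. by rewrite /mon_coef /pcoef mxE; exact: mcoeff0. Qed.

Lemma mon_coefD P u v : mon_coef P (u + v) = mon_coef P u + mon_coef P v.
Proof. by rewrite /mon_coef /pcoef mxE; exact: mcoeffD. Qed.

Lemma mon_coefB P u v : mon_coef P (u - v) = mon_coef P u - mon_coef P v.
Proof. by rewrite /mon_coef /pcoef !mxE; exact: mcoeffB. Qed.

Lemma mon_coef_mterm Q c P : mon_coef Q (mterm c P) = if Q == P then c else 0.
Proof.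
rewrite /mon_coef /pcoef /mterm !mxE eqxx /=; case: Q P => [a k] [b l] /=.
rewrite xpair_eqE andbC; have [_|_] := eqVneq k l; last first.
  by rewrite /= mulr0; exact: mcoeff0.
rewrite mulr1 ptermE /= eq_sym -mulrb; exact: mcoeffU.
Qed.

Lemma pterm_mterm d a c P :
  pterm d a *: mterm c P = mterm (d * c) (mon_shift a P).
Proof. by rewrite /mterm scalerA; congr (_ *: _); exact: pmulUU. Qed.

Lemma mterm_sum v : v = \sum_(P <- mon_supp v) mterm (mon_coef P v) P.
Proof.
rewrite /mon_supp big_allpairs_dep /= big_enum /= [LHS]row_sum_delta.
apply: eq_bigr => l _; rewrite {1}[v 0 l]polyE scaler_suml.
by apply: eq_bigr.
Qed.

Lemma mterm_ind (Pr : 'rV[A]_q -> Prop) v :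
    Pr 0 -> (forall u w, Pr u -> Pr w -> Pr (u + w)) ->
    (forall P, mon_coef P v != 0 -> Pr (mterm (mon_coef P v) P)) ->
  Pr v.
Proof.
move=> Pr0 PrD Prt; rewrite [v]mterm_sum big_seq; apply: big_ind => // P.
by rewrite mem_mon_supp => /Prt.
Qed.

Lemma mon_coef_scale d a P v :
  mon_coef (mon_shift a P) (pterm d a *: v) = d * mon_coef P v.
Proof.
apply: (@mterm_ind (fun w => mon_coef (mon_shift a P) (pterm d a *: w) =
  d * mon_coef P w) v) => [|u w hu hw|Q _].
- by rewrite scaler0 !mon_coef0 mulr0.
- by rewrite scalerDr !mon_coefD hu hw mulrDr.
rewrite pterm_mterm !mon_coef_mterm (inj_eq (@mon_shift_inj n q a)).
by case: eqP; rewrite ?mulr0.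
Qed.

Lemma mon_coef_scale_neq0 d a Q v : mon_coef Q (pterm d a *: v) != 0 ->
  exists2 P, Q = mon_shift a P & mon_coef P v != 0.
Proof.
move=> vQ; apply: NNPP => nP; case/eqP: vQ.
apply: (@mterm_ind (fun w => mon_coef Q (pterm d a *: w) = 0) v) => [|u w hu hw|P vP].
- by rewrite scaler0 mon_coef0.
- by rewrite scalerDr mon_coefD hu hw addr0.
rewrite pterm_mterm mon_coef_mterm; case: eqP => // QP.
by case: nP; exists P.
Qed.

Lemma mon_coefD_neq0 P u v :
  mon_coef P (u + v) != 0 -> mon_coef P u != 0 \/ mon_coef P v != 0.
Proof.
rewrite mon_coefD; have [->|] := eqVneq (mon_coef P u) 0; last by left.
by rewrite add0r; right.
Qed.

Lemma mon_coefB_neq0 P u v :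
  mon_coef P (u - v) != 0 -> mon_coef P u != 0 \/ mon_coef P v != 0.
Proof.
rewrite mon_coefB; have [->|] := eqVneq (mon_coef P u) 0; last by left.
by rewrite sub0r oppr_eq0; right.
Qed.

Lemma scale_factor a v :
    (forall P, mon_coef P v != 0 -> exists Q, P = mon_shift a Q) ->
  exists u, v = pterm 1 a *: u.
Proof.
move=> av; apply: (@mterm_ind (fun v => exists u, v = pterm 1 a *: u) v).
- by exists 0; rewrite scaler0.
- by move=> _ _ [u1 ->] [u2 ->]; exists (u1 + u2); rewrite scalerDr.
move=> P /av[Q ->]; set c := mon_coef _ _.
by exists (mterm c Q); rewrite pterm_mterm mul1r.
Qed.

Definition mon_restr (p : pred (mon n q)) v : 'rV[A]_q :=
  \sum_(P <- mon_supp v | p P) mterm (mon_coef P v) P.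

Lemma mon_coef_restr (p : pred (mon n q)) v P :
  mon_coef P (mon_restr p v) = if p P then mon_coef P v else 0.
Proof.
have out (p' : pred (mon n q)) : ~~ p' P -> mon_coef P (mon_restr p' v) = 0.
  move=> pP; rewrite /mon_restr.
  apply: (big_ind (fun u => mon_coef P u = 0)) => [|u w hu hw|Q pQ]; first exact: mon_coef0.
    by rewrite mon_coefD hu hw addr0.
  by rewrite mon_coef_mterm; case: eqP pP pQ => // -> /negPf->.
case: ifPn => [pP|/out//]; rewrite [in RHS](mterm_sum v) (bigID p) /=.
by rewrite mon_coefD (out (predC p)) ?addr0 //= negbK.
Qed.

End Coefficients.

(** * Leading terms *)

Section LeadingTerm.
Variables (N n q : nat) (gt : rel (mon n q)) (hgt : monomial_order gt).
Local Notation A := (zpoly N n).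
Implicit Types (u v w : 'rV[A]_q) (P Q : mon n q) (c d : Zmod N).

(** Bounds on all monomials, in place of equations on the leading monomial: they
pass to sums and differences whatever cancels, and include the vector 0. *)
Definition below P v := forall Q, mon_coef Q v != 0 -> ge gt P Q.

Definition strictly_below P v := forall Q, mon_coef Q v != 0 -> gt P Q.

Lemma LM_below P v : LM gt v = Some P <-> mon_coef P v != 0 /\ below P v.
Proof.
rewrite LMP //; split=> -[vP hP]; split=> // Q vQ; rewrite ?/ge.
  by have [//|QP /=] := eqVneq; apply: hP.
by move=> QP; have := hP Q vQ; rewrite /ge (negPf QP).
Qed.

Lemma LM_eq0 v : LM gt v = None -> v = 0.
Proof.
move=> LM0; rewrite [v]mterm_sum; move: LM0; rewrite /LM.
by case: mon_supp => [|P s] /=; [rewrite big_nil | case: foldr].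
Qed.

Lemma LM0 : LM gt (0 : 'rV[A]_q) = None.
Proof.
by case E: LM => [P|//]; have /LM_below[] := E; rewrite mon_coef0 eqxx.
Qed.

Lemma LM_neq0 v P : LM gt v = Some P -> v != 0.
Proof. by move=> vP; apply: contra_eq_neq vP => ->; rewrite LM0. Qed.

Lemma below0 P : below P (0 : 'rV[A]_q).
Proof. by move=> Q; rewrite mon_coef0 eqxx. Qed.

Lemma below_coef0 P v : below P v -> mon_coef P v = 0 -> strictly_below P v.
Proof.
move=> vP cP Q vQ; have := vP Q vQ; rewrite /ge => /predU1P[QP|//].
by move: vQ; rewrite QP cP eqxx.
Qed.

Lemma strictly_below_coef P v : strictly_below P v -> mon_coef P v = 0.
Proof. by move=> vP; apply: contraTeq isT => /vP; rewrite gt_irr. Qed.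

Lemma belowB P u v : below P u -> below P v -> below P (u - v).
Proof. by move=> hu hv Q /mon_coefB_neq0[/hu|/hv]. Qed.

Lemma belowD P u v : below P u -> below P v -> below P (u + v).
Proof. by move=> hu hv Q /mon_coefD_neq0[/hu|/hv]. Qed.

Lemma below_scale P v d a :
  below P v -> below (mon_shift a P) (pterm d a *: v).
Proof. by move=> vP Q /mon_coef_scale_neq0[R -> /vP]; rewrite ge_shift. Qed.

Lemma mterm_supp (T : Prop) P Q c :
  (P = Q -> T) -> mon_coef P (mterm c Q : 'rV[A]_q) != 0 -> T.
Proof. by rewrite mon_coef_mterm; case: (P =P Q) => [PQ /(_ PQ)|_]; rewrite ?eqxx. Qed.

Lemma below_mterm P Q c : ge gt P Q -> below P (mterm c Q : 'rV[A]_q).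
Proof. by move=> PQ R; apply: mterm_supp => ->. Qed.

End LeadingTerm.
(** * Division and lifting of syzygies *)

Section Combination.
Variables (A : comPzRingType) (q s : nat) (g : 'I_s -> 'rV[A]_q).

Definition comb (w : 'rV[A]_s) : 'rV[A]_q := \sum_l w 0 l *: g l.

Fact comb_is_linear : linear comb.
Proof.
move=> a u v; rewrite /comb scaler_sumr -big_split /=; apply: eq_bigr => l _.
by rewrite !mxE scalerDl scalerA.
Qed.

HB.instance Definition _ :=
  GRing.isLinear.Build A 'rV[A]_s 'rV[A]_q _ comb comb_is_linear.

Lemma comb_delta c l : comb (c *: delta_mx 0 l) = c *: g l.
Proof.
rewrite linearZ /= /comb (bigD1 l) //= big1 ?addr0 ?mxE ?eqxx ?scale1r //.
by move=> k /negPf kl; rewrite mxE eqxx kl scale0r.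
Qed.

Lemma comb_basis l : comb (delta_mx 0 l) = g l.
Proof. by rewrite -[RHS]scale1r -comb_delta scale1r. Qed.

End Combination.

Definition is_submod (A : comPzRingType) (V : lmodType A) (K : V -> Prop) :=
  [/\ K 0, forall u v, K u -> K v -> K (u + v) & forall a u, K u -> K (a *: u)].

Section Submod.
Variables (A : comPzRingType) (V : lmodType A) (K : V -> Prop).
Hypothesis subK : is_submod K.

Lemma submodB u v : K u -> K v -> K (u - v).
Proof.
case: subK => _ KD KZ Ku Kv; apply: KD => //.
by rewrite -scaleN1r; apply: KZ.
Qed.

Lemma submod_sum I (r : seq I) (F : I -> V) :
  (forall i, K (F i)) -> K (\sum_(i <- r) F i).
Proof. by case: subK => K0 KD _ KF; apply: big_ind => // i _. Qed.

End Submod.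

Lemma ker_submod (A : comPzRingType) (V W : lmodType A) (f : {linear V -> W}) :
  is_submod (fun v => f v = 0).
Proof.
split=> [|u v fu fv|a u fu]; first exact: linear0.
  by rewrite linearD fu fv addr0.
by rewrite linearZ /= fu scaler0.
Qed.

Section Division.
Variables (N n q s : nat) (gt : rel (mon n q)) (hgt : monomial_order gt).
Local Notation A := (zpoly N n).
Variables (g : 'I_s -> 'rV[A]_q) (L : 'I_s -> mon n q).
Hypothesis gL : forall l, below gt (L l) (g l).

(** If [L l] is the leading monomial of [g l], Schreyer's order compares
monomials of the source by their lifts first. *)
Definition lift_mon (Q : mon n s) : mon n q := mon_shift Q.1 (L Q.2).

Lemma lift_shift a Q : lift_mon (mon_shift a Q) = mon_shift a (lift_mon Q).
Proof. by rewrite /lift_mon mon_shiftA. Qed.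

Lemma comb_mterm c Q : comb g (mterm c Q) = pterm c Q.1 *: g Q.2.
Proof. exact: comb_delta. Qed.

Lemma comb_supp (w : 'rV[A]_s) (T : mon n q -> Prop) :
    (forall Q R, mon_coef Q w != 0 -> ge gt (lift_mon Q) R -> T R) ->
  forall R, mon_coef R (comb g w) != 0 -> T R.
Proof.
move=> wT.
apply: (@mterm_ind N n s (fun v => forall R, mon_coef R (comb g v) != 0 -> T R) w).
- by move=> R; rewrite linear0 mon_coef0 eqxx.
- by move=> u v hu hv R; rewrite linearD => /mon_coefD_neq0[/hu|/hv].
move=> Q wQ R; rewrite comb_mterm => /mon_coef_scale_neq0[P -> /gL LP].
by apply: wT wQ _; rewrite /lift_mon ge_shift.
Qed.

Lemma comb_lead c Q :
  mon_coef (lift_mon Q) (comb g (mterm c Q)) = c * mon_coef (L Q.2) (g Q.2).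
Proof. by rewrite comb_mterm /lift_mon mon_coef_scale. Qed.

(** In the image of a syzygy, the coefficient at the highest lift only receives
contributions from the terms that have this lift. *)
Lemma syzygy_top w top P : comb g w = 0 ->
    (forall Q, mon_coef Q (w - top) != 0 -> gt P (lift_mon Q)) ->
  mon_coef P (comb g top) = 0.
Proof.
move=> w0 low; apply: (strictly_below_coef hgt).
have -> : comb g top = - comb g (w - top) by rewrite linearB /= w0 sub0r opprK.
rewrite -linearN; apply: (@comb_supp _ (gt P)) => Q R cQ; apply: gt_ge_trans => //.
apply: low; move: cQ; rewrite -sub0r mon_coefB mon_coef0 sub0r.
by rewrite oppr_eq0.
Qed.

Variable K : 'rV[A]_q -> Prop.
Hypotheses (subK : is_submod K) (Kg : forall l, K (g l)).
Hypothesis leadK : forall v P, K v -> LM gt v = Some P ->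
  exists d Q, lift_mon Q = P /\ mon_coef P v = d * mon_coef (L Q.2) (g Q.2).

Lemma comb_in w : K (comb g w).
Proof. by apply: submod_sum => // l; case: subK => _ _; apply. Qed.

(** Well-founded induction on the leading monomial, cancelling one leading term
at a time. Bounding the lifts by some monomial of the dividend, rather than by
its leading monomial, covers the dividend 0 at the same time. *)
Lemma division v : K v -> exists w, comb g w = v /\
  forall Q, mon_coef Q w != 0 ->
    exists2 P, mon_coef P v != 0 & ge gt P (lift_mon Q).
Proof.
have division0 : exists w, comb g w = 0 /\
  forall Q, mon_coef Q w != 0 ->
    exists2 P, mon_coef P (0 : 'rV[A]_q) != 0 & ge gt P (lift_mon Q).
  by exists 0; rewrite linear0; split=> // Q; rewrite mon_coef0 eqxx.
case E: (LM gt v) => [P|] Kv; last by rewrite (LM_eq0 E).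
elim/(gt_ind hgt): P v E Kv => P IHP v vP Kv.
have [d [Q [QP vd]]] := leadK Kv vP.
have [cP bP] := (LM_below hgt P v).1 vP.
set t := mterm d Q; pose v' := v - comb g t.
have v'P : strictly_below gt P v'.
  apply: below_coef0; last by rewrite mon_coefB -QP comb_lead QP -vd subrr.
  apply: belowB => //; apply: (@comb_supp _ (ge gt P)) => R' R.
  apply: mterm_supp => ->.
  by rewrite QP.
have Kv' : K v' by apply: submodB => //; apply: comb_in.
suff [w [wv' hw]] : exists w, comb g w = v' /\ forall Q, mon_coef Q w != 0 ->
    ge gt P (lift_mon Q).
  exists (w + t); rewrite linearD /= wv' subrK; split=> // R.
  by case/mon_coefD_neq0=> [/hw|]; [exists P | apply: mterm_supp => ->; exists P; rewrite // QP ge_refl].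
case E': (LM gt v') => [P'|]; last first.
  have [w [w0 hw]] := division0; exists w; rewrite w0 (LM_eq0 E'); split=> // R /hw[R'].
  by rewrite mon_coef0 eqxx.
have [cP' _] := (LM_below hgt P' v').1 E'.
have [w [wv' hw]] := IHP P' (v'P _ cP') v' E' Kv'; exists w; split=> // R /hw[R' vR' R'R].
by rewrite /ge (gt_ge_trans hgt (v'P _ vR') R'R) orbT.
Qed.

Lemma division_span v : K v <-> exists w, comb g w = v.
Proof.
split=> [/division[w [wv _]]|[w <-]]; first by exists w.
exact: comb_in.
Qed.

(** All monomials of the image of [top] are smaller than [P], since those at [P]
cancel, and it lies in [K]; dividing it expresses it by terms with lifts smaller
than [P]. This takes the place of the reduction of S-polynomials. *)
Lemma complete_syzygy (top : 'rV[A]_s) P :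
    (forall Q, mon_coef Q top != 0 -> lift_mon Q = P) ->
    mon_coef P (comb g top) = 0 ->
  exists r, comb g (top - r) = 0 /\
    forall Q, mon_coef Q r != 0 -> gt P (lift_mon Q).
Proof.
move=> topP c0; have [r [rE hr]] := division (comb_in top).
exists r; rewrite linearB /= rE subrr; split=> // Q /hr[R cR RQ].
apply: (gt_ge_trans hgt _ RQ); move: R cR {RQ}; apply: below_coef0 c0.
by apply: (@comb_supp _ (ge gt P)) => Q' R' /topP ->.
Qed.

End Division.
(** * Eliminating one indeterminate from the leading terms of the syzygies *)

Section LeadingFree.
Variables (N n : nat) (hN : (0 < N)%N).
Local Notation A := (zpoly N n).

(** A form of the condition that no [X_j] with [j < i] is needed to generate the
leading terms of [K]. Requiring equal leading coefficients, which the finiteness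
of Z/N allows, reduces divisibility of terms to divisibility of monomials. *)
Definition lead_free (i : nat) q (gt : rel (mon n q)) (K : 'rV[A]_q -> Prop) :=
  forall v P, K v -> LM gt v = Some P ->
  exists v' P', [/\ K v', LM gt v' = Some P', mdvd P' P,
    mon_coef P' v' = mon_coef P v & forall j : 'I_n, (j < i)%N -> P'.1 j = 0%N].

Lemma lead_free0 q (gt : rel (mon n q)) K : lead_free 0 gt K.
Proof.
move=> v P Kv vP; exists v, P; split=> //.
by apply/mdvdP; exists mone; rewrite mon_shift1.
Qed.

(** A finite Groebner basis, by Dickson's lemma applied to pairs of an element
and its leading monomial, with the leading coefficient as the bounded measure.
Sorting by the exponent of [X_t] prepares the elimination of [X_t]. *)
Lemma lead_free_basis i q (gt : rel (mon n q)) K (t : 'I_n) :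
    lead_free i gt K ->
  exists s (g : 'I_s -> 'rV[A]_q) (L : 'I_s -> mon n q),
  [/\ forall l, K (g l) /\ LM gt (g l) = Some (L l),
      forall l (j : 'I_n), (j < i)%N -> (L l).1 j = 0%N,
      forall v P, K v -> LM gt v = Some P ->
        exists2 l, mdvd (L l) P & mon_coef (L l) (g l) = mon_coef P v
    & forall k l : 'I_s, (k <= l)%N -> ((L l).1 t <= (L k).1 t)%N].
Proof.
move=> freeK; pose T : eqType := ('rV[A]_q * mon n q)%type.
pose S (x : T) := [/\ K x.1, LM gt x.1 = Some x.2 &
  forall j : 'I_n, (j < i)%N -> x.2.1 j = 0%N].
pose c (x : T) := Defs.repr_of (mon_coef x.2 x.1).
have cN x : (c x <= N)%N by rewrite ltnW // repr_of_lt.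
have [B [SB hB]] := @dickson_mon n q T snd c N S cN.
pose le (x y : T) := (y.2.1 t <= x.2.1 t)%N.
have le_trans : transitive le by move=> y x z xy yz; apply: leq_trans yz xy.
have le_total : total le by move=> x y; apply: leq_total.
pose C := in_tuple (sort le B).
have SC l : S (tnth C l) by apply: SB; rewrite -(mem_sort le) mem_tnth.
exists (size (sort le B)), (fun l => (tnth C l).1), (fun l => (tnth C l).2).
split=> [l|l|v P Kv vP|k l kl]; try by case: (SC l).
  have [v' [P' [Kv' vP' P'P vE P'i]]] := freeK _ _ Kv vP.
  have [|y yB [yP' cy]] := hB (v', P'); first by split.
  have /tnthP[l yl] : y \in C by rewrite mem_sort.
  exists l; rewrite -yl; last by rewrite -vE; apply: val_inj.
  have /mdvdP[a ->] := P'P; have /mdvdP[b /= ->] := yP'.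
  by apply/mdvdP; exists (mmul a b); rewrite mon_shiftA.
have [x0 _] : exists x0 : T, true by exists (tnth C k).
have := sorted_leq_nth le_trans (fun x => leqnn (x.2.1 t)) x0
  (sort_sorted le_total B).
rewrite (tnth_nth x0 C k) (tnth_nth x0 C l); apply => //; rewrite inE; exact: ltn_ord.
Qed.

Section Schreyer.
Variables (q s : nat) (gt : rel (mon n q)) (hgt : monomial_order gt).
Variables (g : 'I_s -> 'rV[A]_q) (L : 'I_s -> mon n q).
Hypothesis gL : forall l, LM gt (g l) = Some (L l).

Lemma schreyerE P Q : schreyer gt g P Q =
  gt (lift_mon L P) (lift_mon L Q) ||
  (lift_mon L P == lift_mon L Q) && (P.2 < Q.2)%N.
Proof. by rewrite /schreyer !gL. Qed.

Lemma schreyer_order : monomial_order (schreyer gt g).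
Proof.
have [irr tr tot pos sh] := hgt.
split=> [P|Q P R|P Q PQ|a P a1|a P Q].
- by rewrite schreyerE irr ltnn andbF.
- rewrite !schreyerE => /orP[PQ|/andP[/eqP-> PQ]] /orP[QR|/andP[/eqP<- QR]].
  + by rewrite (tr _ _ _ PQ QR).
  + by rewrite PQ.
  + by rewrite QR.
  + by rewrite eqxx (ltn_trans PQ QR) orbT.
- rewrite !schreyerE; have [e|/tot/orP[->|->]] := eqVneq (lift_mon L P) (lift_mon L Q);
    rewrite ?orbT //.
  rewrite e irr /= -neq_ltn; apply: contra PQ => /eqP/val_inj PQ2.
  case: P Q e PQ2 => [a k] [b l] /= + kl; rewrite -{}kl /lift_mon /=.
  by move/mon_shift_injl => ->.
- by rewrite schreyerE lift_shift pos.
rewrite !schreyerE !lift_shift (gt_shift hgt) => /orP[->//|/andP[/eqP-> ->]].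
by rewrite eqxx orbT.
Qed.

Lemma schreyer_ge_lift P Q :
  ge (schreyer gt g) P Q -> ge gt (lift_mon L P) (lift_mon L Q).
Proof.
rewrite /ge schreyerE => /orP[/eqP->|/orP[->|/andP[/eqP-> _]]]; rewrite ?eqxx ?orbT //.
Qed.

Variable K : 'rV[A]_q -> Prop.
Hypotheses (subK : is_submod K) (Kg : forall l, K (g l)).
Hypothesis leadK : forall v P, K v -> LM gt v = Some P ->
  exists2 l, mdvd (L l) P & mon_coef (L l) (g l) = mon_coef P v.

Lemma gL_below l : below gt (L l) (g l).
Proof. by have /LM_below[] := gL l. Qed.

Lemma lead_liftK v P : K v -> LM gt v = Some P ->
  exists d Q, lift_mon L Q = P /\ mon_coef P v = d * mon_coef (L Q.2) (g Q.2).
Proof.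
move=> Kv vP; have [l /mdvdP[a Pl] lv] := leadK Kv vP.
by exists 1, (a, l); rewrite mul1r.
Qed.

Lemma groebner_span v : K v <-> exists w, comb g w = v.
Proof. exact: (division_span hgt gL_below subK Kg lead_liftK). Qed.

Variable t : 'I_n.
Hypothesis freeL : forall l (j : 'I_n), (j < t)%N -> (L l).1 j = 0%N.
Hypothesis sortL : forall k l : 'I_s, (k <= l)%N -> ((L l).1 t <= (L k).1 t)%N.

(** Let [Q] be the leading monomial of the syzygy [w]. The terms of [w] with the
same lift as [Q] form a vector [top], all of whose monomials are divisible by
the part [d] of [Q] in the first [t.+1] indeterminates; [top] divided by [d] is
completed to a syzygy with the desired leading term. *)
Lemma schreyer_lead_free :
  lead_free t.+1 (schreyer gt g) (fun w => comb g w = 0).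
Proof.
move=> w Q w0 /(LM_below schreyer_order)[cQ wQ].
set P := lift_mon L Q.
have lowP R : mon_coef R w != 0 -> ge gt P (lift_mon L R).
  by move/wQ/schreyer_ge_lift.
pose d : 'X_{1..n} := [cmonom Q.1 j | j in [fset j : 'I_n | (j <= t)%N]%fset]%M.
have dE j : d j = if (j <= t)%N then Q.1 j else 0%N.
  by rewrite /d cmE fsfun_fun in_fset.
pose top := mon_restr (fun R => lift_mon L R == P) w.
have topE R : mon_coef R top != 0 -> lift_mon L R = P /\ mon_coef R w != 0.
  by rewrite mon_coef_restr; case: (lift_mon L R =P P) => // _; rewrite eqxx.
have top0 : mon_coef P (comb g top) = 0.
  apply: (syzygy_top hgt gL_below w0) => R; rewrite mon_coefB mon_coef_restr /=.
  have [_|RP] := eqVneq (lift_mon L R) P; first by rewrite subrr eqxx.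
  by rewrite subr0 => /lowP; rewrite /ge (negPf RP).
have d_top R : lift_mon L R = P -> mon_coef R w != 0 ->
    exists R', R = mon_shift d R'.
  move=> RP cR; exists (divcm R.1 d, R.2); case: R RP cR => a l RP cR.
  congr pair; apply/eqP/cmP=> j /=; rewrite cmM divcmE subnKC // dE.
  case: ifP => // jt; have /eqP/cmP/(_ j) := congr1 fst RP.
  rewrite !cmM /= => alj.
  (* For [j < t] the basis elements do not contain [X_j]; for [j = t] the ties
  in Schreyer's order are broken towards smaller indices, that is, towards
  larger exponents of [X_t] in the basis elements. *)
  move: jt; rewrite leq_eqVlt => /predU1P[/val_inj jt|jt].
    rewrite -(leq_add2r ((L Q.2).1 j)) -alj leq_add2l jt; apply: sortL.
    have := wQ _ cR; rewrite /ge schreyerE RP eqxx (gt_irr hgt) /=.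
    by case/predU1P=> [<-//|]; apply: ltnW.
  by move: alj; rewrite !freeL // !addn0 => ->.
have cQt : mon_coef Q top != 0 by rewrite mon_coef_restr eqxx.
have [Q' QE] := d_top Q erefl cQ.
have [top' top'E] : exists top', top = pterm 1 d *: top'.
  by apply: scale_factor => R /topE[]; apply: d_top.
have coef' R : mon_coef R top' = mon_coef (mon_shift d R) top.
  by rewrite top'E mon_coef_scale mul1r.
pose P' := lift_mon L Q'; have PE : P = mon_shift d P' by rewrite -lift_shift -QE.
have [||r [r0 rP]] := complete_syzygy (top := top') (P := P') hgt gL_below subK Kg lead_liftK.
- move=> R; rewrite coef' => /topE[+ _]; rewrite lift_shift PE.
  exact: mon_shift_inj.
- have: mon_coef P (comb g top) = 1 * mon_coef P' (comb g top').
    by rewrite top'E linearZ /= PE mon_coef_scale.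
  by rewrite top0 mul1r.
have rQ' : mon_coef Q' r = 0.
  by apply/eqP/negPn/negP => /rP; rewrite (gt_irr hgt).
exists (top' - r), Q'; split=> //.
- apply/(LM_below schreyer_order); split.
    by rewrite mon_coefB coef' -QE rQ' subr0.
  apply: belowB => R.
    rewrite coef' => /topE[_ /wQ]; rewrite QE ge_shift //; exact: schreyer_order.
  by move/rP=> PR; rewrite /ge schreyerE PR orbT.
- by apply/mdvdP; exists d.
- by rewrite mon_coefB coef' -QE rQ' subr0 mon_coef_restr eqxx.
move=> j; rewrite ltnS => jt.
have /eqP/cmP/(_ j)/eqP := congr1 fst QE; rewrite cmM dE jt.
by rewrite -{1}[Q.1 j]addn0 eqn_add2l => /eqP.
Qed.

End Schreyer.
End LeadingFree.
(** * Leading terms without indeterminates *)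

Section Pivots.
Variables (N n : nat) (hN : (0 < N)%N).
Local Notation A := (zpoly N n).
Local Notation e k := ((mone, k) : mon n _).

(** A Groebner basis with one element for each basis vector [e_k]. If [b k = 0],
the bound alone would leave [u k] free below [e_k]; asking for [u k = 0] gives
[LT (u k) = b k e_k] in all cases. *)
Definition pivots q (gt : rel (mon n q)) (K : 'rV[A]_q -> Prop)
    (b : 'I_q -> Zmod N) (u : 'I_q -> 'rV[A]_q) :=
  [/\ forall k, K (u k),
      forall k, below gt (e k) (u k) /\ mon_coef (e k) (u k) = b k,
      forall k, b k = 0 -> u k = 0
    & forall v P, K v -> LM gt v = Some P ->
        exists d, mon_coef P v = d * b P.2].

Section Order.
Variables (q : nat) (gt : rel (mon n q)) (hgt : monomial_order gt).
Variable K : 'rV[A]_q -> Prop.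
Hypothesis subK : is_submod K.

(** For each [k], the coefficients at [e_k] of the elements of [K] bounded by
[e_k] form an ideal of Z/N, and [b k] is a generator of it. *)
Lemma lead_free_pivots : lead_free n gt K ->
  exists b u, pivots gt K b u /\ forall k, N_over_gcd (N_over_gcd (b k)) = b k.
Proof.
move=> freeK; have [K0 KD KZ] := subK.
pose I k c := exists v, [/\ K v, below gt (e k) v & mon_coef (e k) v = c].
have I0 k : I k 0 by exists 0; split; rewrite ?mon_coef0 //; apply: below0.
have ID k x y : I k x -> I k y -> I k (x + y).
  move=> [v [Kv bv <-]] [w [Kw bw <-]]; exists (v + w).
  by rewrite mon_coefD; split; [apply: KD|apply: belowD|].
have IM k d x : I k x -> I k (d * x).
  move=> [v [Kv bv <-]]; exists (pterm d mone *: v).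
  split; first exact: KZ.
    by rewrite -[e k]mon_shift1; apply: below_scale.
  by rewrite -{1}[e k]mon_shift1 mon_coef_scale.
have pick k : exists bu : Zmod N * 'rV[A]_q,
  [/\ K bu.2, below gt (e k) bu.2 /\ mon_coef (e k) bu.2 = bu.1,
      bu.1 = 0 -> bu.2 = 0, N_over_gcd (N_over_gcd bu.1) = bu.1
    & forall c, I k c -> exists d, c = d * bu.1].
  have [b [[v [Kv bv vb]] bb Ib]] := zmod_principal hN (I0 k) (@ID k) (@IM k).
  have [b0|b0] := eqVneq b 0; last by exists (b, v); split=> //= b0'; rewrite b0' eqxx in b0.
  exists (b, 0); split=> //=; split; first exact: below0.
  by rewrite mon_coef0 b0.
have [bu buP] := fin_all_exists pick.
exists (fun k => (bu k).1), (fun k => (bu k).2); split; last by move=> k; case: (buP k).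
split=> [k|k|k|v P Kv vP]; try by case: (buP k).
have [v' [P' [Kv' v'P' P'P <- P'0]]] := freeK _ _ Kv vP.
have {}P'0 : P'.1 = mone by apply/eqP/cmP=> j; rewrite cm1 P'0.
case: (buP P.2) => _ _ _ _; apply; exists v'.
have [_ bv'] := (LM_below hgt P' v').1 v'P'.
have -> : e P.2 = P' by case: P' P'0 P'P {v'P' bv'} => a k /= -> /andP[/eqP/= ->].
by split.
Qed.

Variables (b : 'I_q -> Zmod N) (u : 'I_q -> 'rV[A]_q).
Hypothesis pivu : pivots gt K b u.

Let L (k : 'I_q) : mon n q := e k.

Let lift_id Q : lift_mon L Q = Q.
Proof. by case: Q => a k; rewrite /lift_mon /mon_shift mulm1. Qed.

Let belowu k : below gt (L k) (u k). Proof. by case: pivu => _ /(_ k)[]. Qed.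

Let Ku k : K (u k). Proof. by case: pivu. Qed.

Let leadu v P : K v -> LM gt v = Some P ->
  exists d Q, lift_mon L Q = P /\ mon_coef P v = d * mon_coef (L Q.2) (u Q.2).
Proof.
case: pivu => _ cu _ Kb Kv /(Kb _ _ Kv)[d vd]; exists d, P.
by rewrite lift_id; case: (cu P.2) => _ ->.
Qed.

Lemma pivots_span v : K v <-> exists w, comb u w = v.
Proof. exact: (division_span hgt belowu subK Ku leadu). Qed.

Lemma pivots_LM k P : LM gt (u k) = Some P -> P = e k.
Proof.
case/(LM_below hgt)=> cP bP; case: pivu => _ /(_ k)[bk ck] /(_ k) u0 _.
have [bk0|bk0] := eqVneq (b k) 0; first by rewrite u0 // mon_coef0 eqxx in cP.
have := bk _ cP; have := bP (e k); rewrite ck => /(_ bk0).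
rewrite [ge gt P _](geNgt hgt) /ge; by case: eqP => // _ /negPf ->.
Qed.

(** The lift of a monomial is that monomial itself, so the same order [gt] can
be used on the source. The coefficient at the leading monomial [P] of a syzygy
annihilates [b P.2], and [N / gcd(N, b k)] is killed by [b k], which allows the
completion of this multiple of [e_k] to a syzygy. *)
Lemma pivots_syzygies :
  exists u', pivots gt (fun w => comb u w = 0) (fun k => N_over_gcd (b k)) u'.
Proof.
have cu k : mon_coef (e k) (u k) = b k by case: pivu => _ /(_ k)[].
have pick k : exists v : 'rV[A]_q,
  [/\ comb u v = 0, below gt (e k) v /\ mon_coef (e k) v = N_over_gcd (b k)
    & N_over_gcd (b k) = 0 -> v = 0].
  have [b0|b0] := eqVneq (N_over_gcd (b k)) 0.
    by exists 0; rewrite linear0 mon_coef0 b0; split=> //; split=> //; apply: below0.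
  pose top : 'rV[A]_q := mterm (N_over_gcd (b k)) (e k).
  have [||r [r0 rk]] := complete_syzygy (top := top) (P := e k) hgt belowu subK Ku leadu.
  - by move=> Q; apply: mterm_supp => ->; rewrite lift_id.
  - rewrite -[e k]lift_id comb_lead cu; apply/(zmod_annP hN); exists 1.
    by rewrite mul1r.
  exists (top - r); split=> [//||b0']; last by rewrite b0' eqxx in b0.
  split.
    apply: belowB => [|R /rk]; first by apply: below_mterm; apply: ge_refl.
    by rewrite lift_id /ge => ->; rewrite orbT.
  rewrite mon_coefB mon_coef_mterm eqxx.
  suff -> : mon_coef (e k) r = 0 by rewrite subr0.
  by apply/eqP/negPn/negP => /rk; rewrite lift_id (gt_irr hgt).
have [u' u'P] := fin_all_exists pick.
exists u'; split=> [k|k|k|w P w0 /(LM_below hgt)[cP wP]]; try by case: (u'P k).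
apply/(zmod_annP hN); rewrite -cu -[P in mon_coef P w]lift_id -comb_lead lift_id.
rewrite -{1}[P]lift_id; apply: (syzygy_top hgt belowu w0) => Q.
rewrite !lift_id mon_coefB mon_coef_mterm; have [->|QP] := eqVneq Q P.
  by rewrite subrr eqxx.
by rewrite subr0 => /wP; rewrite /ge (negPf QP).
Qed.

Lemma pivots_LT : same_submod (LT_submod gt K) (dsum_ideals b).
Proof.
have [_ cu u0 Kb] := pivu; move=> v; split.
  case=> k [a [g [gK ->]]].
  have {}gK i : dsum_ideals b (a i *: g i).
    have [w Kw ->] := gK i; rewrite /LT; case wP: LM => [P|]; last first.
      exists (fun=> 0) => [j|]; first by exists 0; rewrite mul0r.
      by rewrite scaler0 big1 // => j _; rewrite scale0r.
    rewrite /LC wP; have [d ->] := Kb _ _ Kw wP.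
    exists (fun j => if j == P.2 then a i * pterm d P.1 * pconst n (b j) else 0) => [j|].
      by case: eqP => _; [exists (a i * pterm d P.1) | exists 0; rewrite mul0r].
    rewrite (bigD1 P.2) //= eqxx big1 ?addr0 => [|j /negPf->]; last by rewrite scale0r.
    rewrite /mon_vec !scalerA; congr (_ *: _); rewrite -!mulrA; congr (_ * _).
    by rewrite /pconst; apply: etrans (pmulUU _ _ _ _) _; symmetry;
       apply: etrans (pmulUU _ _ _ _) _; rewrite mul1m mulm1 mulr1.
  have [c cb ->] : exists2 c : 'I_k -> 'I_q -> A,
      forall i j, ideal_gen (pconst n (b j)) (c i j) &
      \sum_(i < k) a i *: g i = \sum_(i < k) \sum_(j < q) c i j *: basis_vec N n j.
    have /fin_all_exists[c cP] : forall i : 'I_k, exists c : 'I_q -> A,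
        (forall j, ideal_gen (pconst n (b j)) (c j)) /\
        a i *: g i = \sum_(j < q) c j *: basis_vec N n j.
      by move=> i; have [c] := gK i; exists c.
    exists c => [i|]; first by case: (cP i).
    by apply: eq_bigr => i _; case: (cP i).
  exists (fun j => \sum_i c i j) => [j|].
    have /fin_all_exists[d dP] : forall i, exists d, c i j = d * pconst n (b j).
      by move=> i; have [d] := cb i j; exists d.
    by exists (\sum_i d i); rewrite mulr_suml; apply: eq_bigr => i _.
  rewrite exchange_big /=; apply: eq_bigr => j _; by rewrite scaler_suml.
case=> c cb ->; have /fin_all_exists[d dP] := cb.
exists q, d, (fun k => LT gt (u k)); split=> [k|]; first by exists (u k).
apply: eq_bigr => k _; rewrite dP -scalerA; congr (_ *: _).
rewrite /LT; case E: LM => [P|]; last first.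
  have uk0 := LM_eq0 E; have [_] := cu k; rewrite uk0 mon_coef0 => <-.
  by rewrite /pconst pterm0 scale0r.
rewrite /LC E (pivots_LM E); have [_ ->] := cu k; congr (_ *: _).
by rewrite /mon_vec /= -[pterm 1 mone]/(pconst n 1) scale1r.
Qed.

End Order.
End Pivots.
(** * The resolution *)

Lemma LT_submod_ext (N n q : nat) (gt : rel (mon n q))
    (W W' : 'rV[zpoly N n]_q -> Prop) :
  same_submod W W' -> same_submod (LT_submod gt W) (LT_submod gt W').
Proof.
move=> WW' v; split=> -[k [a [h [hW ->]]]]; exists k, a, h; split=> // i;
  by have [w /WW' Ww ->] := hW i; exists w.
Qed.

(** Dependent choice. The first term stays apart so that it is [x0] by
computation, in the way ranks and maps of a resolution treat degree 0. *)
Lemma chain_exists (T : Type) (ok : nat -> T -> Prop)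
    (step : nat -> T -> T -> Prop) (x0 : T) :
    ok 0%N x0 ->
    (forall i x, ok i x -> exists y, ok i.+1 y /\ step i x y) ->
  exists x : nat -> T, let x' i := if i is j.+1 then x j else x0 in
    forall i, ok i (x' i) /\ step i (x' i) (x' i.+1).
Proof.
move=> ok0 next.
pose nxt i x := epsilon (inhabits x0) (fun y => ok i.+1 y /\ step i x y).
have nxtP i x : ok i x -> ok i.+1 (nxt i x) /\ step i x (nxt i x).
  by move=> /next; apply: epsilon_spec.
pose x := fix x i := if i is j.+1 then nxt j (x j) else x0.
have okx i : ok i (x i) by elim: i => [|i /nxtP[]].
exists (fun i => x i.+1) => x' i; have [_ stepi] := nxtP _ _ (okx i).
by case: i stepi => [|i]; split=> //; apply: okx.
Qed.

(** A free module of the resolution with its order, the kernel of the map that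
leaves it, and, from stage [n] on, generators of the leading ideals of this
kernel. Equality of stages carries along the equality of ranks. *)
Record stage (N n : nat) := Stage {
  srank : nat;
  sord : rel (mon n srank);
  sker : 'rV[zpoly N n]_srank -> Prop;
  sgen : 'I_srank -> Zmod N
}.

Arguments sord {N n} S : rename.
Arguments sker {N n} S : rename.
Arguments sgen {N n} S : rename.

Section Stages.
Variables (N n : nat) (hN : (0 < N)%N).
Local Notation A := (zpoly N n).
Local Notation stage := (stage N n).

Definition stage_ok i (S : stage) :=
  [/\ monomial_order (sord S), is_submod (sker S),
      (i <= n)%N -> lead_free i (sord S) (sker S)
    & (n <= i)%N -> exists u, pivots (sord S) (sker S) (sgen S) u /\
        forall k, N_over_gcd (N_over_gcd (sgen S k)) = sgen S k].

Definition stage_map i (S S' : stage)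
    (f : {linear 'rV[A]_(srank S') -> 'rV[A]_(srank S)}) :=
  [/\ forall v, sker S v <-> exists w, f w = v,
      forall w, sker S' w <-> f w = 0,
      (i < n)%N -> (forall l, f (basis_vec N n l) != 0) /\
        forall P Q, sord S' P Q = schreyer (sord S) (fun l => f (basis_vec N n l)) P Q
    & (n <= i)%N -> (forall l, ~ has_indeterminates (sord S) (f (basis_vec N n l))) /\
        exists K, S' = Stage (sord S) K (fun j => N_over_gcd (sgen S j))].

Lemma stage_next i S : stage_ok i S ->
  exists S', stage_ok i.+1 S' /\ exists f, @stage_map i S S' f.
Proof.
case: S => q gt K b [/= hgt subK free piv].
have [ni|ni] := leqP n i.
  have [u [pu bb]] := piv ni; have [u' pu'] := pivots_syzygies hN hgt subK pu.
  exists (Stage gt (fun w => comb u w = 0) (fun k => N_over_gcd (b k))); split.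
    split=> //=; [exact: ker_submod|by rewrite ltnNge ni|move=> _].
    by exists u'; split=> // k; rewrite bb.
  exists (comb u); split=> //= [v||_]; [exact: (pivots_span hgt subK pu)|by rewrite ltnNge ni|].
  split; last by exists (fun w => comb u w = 0).
  move=> l; rewrite [comb u _]comb_basis => -[P /(pivots_LM hgt pu) ->].
  by rewrite eqxx.
have [s [g [L [KL freeL leadK sortL]]]] :=
  lead_free_basis hN (Ordinal ni) (free (ltnW ni)).
have [Kg gL] : (forall l, K (g l)) /\ (forall l, LM gt (g l) = Some (L l)).
  by split=> l; case: (KL l).
have hgt' := schreyer_order hgt gL.
have subK' : is_submod (fun w => comb g w = 0) := ker_submod (comb g).
have free' : lead_free i.+1 (schreyer gt g) (fun w => comb g w = 0) :=
  schreyer_lead_free (t := Ordinal ni) hgt gL subK Kg leadK freeL sortL.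
have [b' b'P] : exists b' : 'I_s -> Zmod N, (n <= i.+1)%N ->
    exists u, pivots (schreyer gt g) (fun w => comb g w = 0) b' u /\
      forall k, N_over_gcd (N_over_gcd (b' k)) = b' k.
  (* The generators are only chosen when stage [n] is reached. *)
  have [ni1|] := eqVneq n i.+1; last first.
    by rewrite eqn_leq ni andbT => /negPf ni1; exists (fun=> 0); rewrite ni1.
  have [|b' [u bu]] := lead_free_pivots hN hgt' subK'.
    by rewrite -ni1 in free'.
  by exists b' => _; exists u.
exists (Stage (schreyer gt g) (fun w => comb g w = 0) b'); split; first by split.
exists (comb g); split=> //= [v|_|].
- exact: (groebner_span hgt gL subK Kg leadK).
- split=> [l|P Q]; first by rewrite [comb g _]comb_basis (LM_neq0 hgt (gL l)).
  by rewrite /schreyer ![comb g _]comb_basis.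
by rewrite leqNgt ni.
Qed.

Lemma stage_shape (S S' S0 : stage) b :
    (exists K, S = Stage (sord S0) K b) ->
    (exists K, S' = Stage (sord S) K (fun j => N_over_gcd (sgen S j))) ->
  exists K, S' = Stage (sord S0) K (fun j => N_over_gcd (b j)).
Proof. by move=> [K ->] [K' ->]; exists K'. Qed.

Lemma stage_LT i S q gt K b :
    stage_ok i S -> (n <= i)%N -> S = @Stage N n q gt K b ->
  forall e : srank S = q, same_submod (LT_submod (sord S) (sker S))
    (dsum_ideals (fun j => b (cast_ord e j))).
Proof.
move=> [hgt subK _ piv] /piv[u [pu _]] SE; subst S => e v.
have -> : (fun j => b (cast_ord e j)) = b.
  by apply: functional_extensionality => j; rewrite cast_ord_id.
exact: (pivots_LT hgt pu v).
Qed.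

End Stages.

Theorem theorem6p9 (N n m : nat) (hN : (0 < N)%N) (hn : (0 < n)%N)
    (hm : (0 < m)%N)
    (U : 'rV[zpoly N n]_m -> Prop) (hU : fg_submod U)
    (M : lmodType (zpoly N n)) (pi : {linear 'rV[zpoly N n]_m -> M})
    (pi_surj : forall x : M, exists v, pi v = x)
    (pi_ker : forall v, pi v = 0 <-> U v)
    (gt0 : rel (mon n m)) (hgt0 : monomial_order gt0) :
  exists (rk : nat -> nat) (phi : res_maps m M rk)
         (gt : forall i, rel (mon n (res_rank m rk i))),
    [/\ is_resolution phi,
        (forall v, phi 0%N v = pi v) /\ (forall P Q, gt 0%N P Q = gt0 P Q),
        forall i, monomial_order (gt i),
        forall i,
          let g l : 'rV[zpoly N n]_(res_rank m rk i) := phi i.+1 (basis_vec N n l) in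
          (exists l, has_indeterminates (gt i) (g l)) ->
          (forall l, g l != 0) /\
          (forall P Q, gt i.+1 P Q = schreyer (gt i) g P Q)
      & exists (p : nat)
          (rk_p : forall i, res_rank m rk (p + i) = res_rank m rk p)
          (b : 'I_(res_rank m rk p) -> Zmod N),
          (p <= n.+1)%N /\
          forall k : nat,
            same_submod
              (LT_submod (gt (p + k.*2)%N) (fun v => phi (p + k.*2)%N v = 0))
              (dsum_ideals (fun j => b (cast_ord (rk_p k.*2) j))) /\
            same_submod
              (LT_submod (gt (p + k.*2.+1)%N) (fun v => phi (p + k.*2.+1)%N v = 0))
              (dsum_ideals (fun j => N_over_gcd (b (cast_ord (rk_p k.*2.+1) j))))].
Proof.
destruct n as [|n']; first by [].
pose S0 := Stage gt0 (fun v => pi v = 0) (fun=> 0).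
have ok0 : stage_ok 0 S0.
  by split=> //=; [exact: ker_submod | move=> _; exact: lead_free0].
have [st stP] := chain_exists ok0 (@stage_next N n'.+1 hN).
pose S i := if i is j.+1 then st j else S0.
have okS i : stage_ok i (S i) := (stP i).1.
pose f i := constructive_indefinite_description _ (stP i).2.
pose rk i := srank (st i).
pose phi : res_maps m M rk := fun i =>
  match i return {linear 'rV[zpoly N n'.+1]_(res_rank m rk i) -> res_target m M rk i} with
  | 0 => pi
  | 1 => proj1_sig (f 0%N)
  | j.+2 => proj1_sig (f j.+1)
  end.
pose gt i : rel (mon n'.+1 (res_rank m rk i)) :=
  match i return rel (mon n'.+1 (res_rank m rk i)) with
  | 0 => gt0
  | j.+1 => sord (st j)
  end.
have fP i := proj2_sig (f i).
have phi_ker i v : phi i.+1 v = 0 <-> sker (st i) v.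
  case: i v => [|i] v; apply: iff_sym; first by have [_ kerf _ _] := fP 0%N.
  by have [_ kerf _ _] := fP i.+1.
have shape i : exists K, S (n'.+1 + i)%N = Stage (sord (S n'.+1)) K
    (if odd i then fun j => N_over_gcd (sgen (S n'.+1) j) else sgen (S n'.+1)).
  elim: i => [|i IHi]; first by exists (sker (S n'.+1)); rewrite addn0; case: (S _).
  have [_ _ _ /(_ (leq_addr _ _))[_ Si]] := fP (n'.+1 + i)%N.
  have [K SK] := stage_shape IHi Si; exists K; rewrite addnS.
  apply: etrans SK _; congr Stage.
  apply: functional_extensionality => j; rewrite /=; case: odd => //=.
  by have [_ _ _ /(_ (leqnn _))[u [_ ->]]] := okS n'.+1.
have rank i : res_rank m rk (n'.+1 + i) = res_rank m rk n'.+1.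
  by have [K SK] := shape i; apply: (congr1 (@srank N n'.+1) SK).
exists rk, phi, gt; split.
- split=> [|[|i] v]; first exact: pi_surj.
    by have [spanf _ _ _] := fP 0%N; apply: spanf.
  rewrite phi_ker; have [spanf _ _ _] := fP i.+1; exact: spanf.
- by split.
- by move=> [|i]; [exact: hgt0 | case: (okS i.+1)].
- case=> [|i] g [l indet]; first by have [_ _ sch _] := fP 0%N; apply: (sch isT).
  have [_ _ sch free] := fP i.+1.
  have [ni|ni] := ltnP i.+1 n'.+1; first exact: (sch ni).
  by have [/(_ l)[]] := free ni.
exists n'.+1, rank, (sgen (S n'.+1)); split=> // k.
have LTk i : same_submod
    (LT_submod (gt (n'.+1 + i)%N) (fun v => phi (n'.+1 + i)%N v = 0))
    (dsum_ideals (fun j => (if odd i then fun j => N_over_gcd (sgen (S n'.+1) j)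
      else sgen (S n'.+1)) (cast_ord (rank i) j))).
  have [K SK] := shape i.
  have LTi := stage_LT (okS _) (leq_addr _ _) SK (rank i).
  by move=> v; apply: iff_trans (LTi v); apply: LT_submod_ext => w; apply: phi_ker.
by split; [have := LTk k.*2 | have := LTk k.*2.+1]; rewrite /= odd_double.
Qed.
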